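(* For any $s\in(0,1]$ there exists a $(\rho(s),\chi(s))$-bidding profile, where \[ \rho(s):=\frac{e^s}{s},\qquad \chi(s):=\begin{cases}(e^s-1)/s, & 0<s\le\ln 2,\\ \xi(s)/s, & \ln2\le s\le 1,\end{cases} \] and $\xi(s)$ is the unique solution $\xi\in[1,e]$ of $\xi(2-\ln\xi)=e^s$ for $s\in[\ln 2,1]$.
   Context: Given $1<\chi\le\rho$, a $(\rho,\chi)$-bidding profile is a non-decreasing, left-continuous function $G:\mathbb{R}\to(0,\infty)$ such that (offset) $G(x)<1$ for every $x<0$ and $G(x)\ge1$ for every $x>0$; (robustness) $\int_{-\infty}^{x+1}G(t)\,\mathrm{d} t\le\rho\,G(x)$ for every $x\in\mathbb{R}$; (consistency) $\int_{-\infty}^{1}G(t)\,\mathrm{d} t\le\chi$. *)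

(* Defs.v *)
From HB Require Import structures.
From mathcomp Require Import all_boot all_order all_algebra.
From mathcomp Require Import all_classical all_reals all_analysis.
Set Implicit Arguments. Unset Strict Implicit. Unset Printing Implicit Defensive.
Import Order.TTheory GRing.Theory Num.Theory.
Import numFieldNormedType.Exports.
Local Open Scope classical_set_scope.
Local Open Scope ring_scope.

(* A (rho,chi)-bidding profile, exactly as in the paper.  Integrals are
   Lebesgue integrals with values in the extended reals, so a divergent
   integral equals +oo and makes the inequality false. *)
Definition bidding_profile (R : realType) (rho chi : R) (G : R -> R) : Prop :=
  {homo G : x y / x <= y} /\
      (forall x : R, G t @[t --> x^'-] --> G x) /\
      (forall x : R, 0 < G x) /\
      (forall x : R, x < 0 -> G x < 1) /\
      (forall x : R, 0 < x -> 1 <= G x) /\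
      (forall x : R,
         (\int[@lebesgue_measure R]_(t in `]-oo, (x + 1)%R]) (G t)%:E
           <= (rho * G x)%R%:E)%E) /\
    (\int[@lebesgue_measure R]_(t in `]-oo, 1%R]) (G t)%:E <= chi%:E)%E.

Definition rho_s (R : realType) (s : R) : R := expR s / s.

Definition xi_s (R : realType) (s : R) : R :=
  xget 1 [set xi : R | 1 <= xi <= expR 1 /\ xi * (2 - ln xi) = expR s].

Definition chi_s (R : realType) (s : R) : R :=
  if s <= ln 2 then (expR s - 1) / s else xi_s s / s.

(* Main.v *)
Require Import Defs.
From HB Require Import structures.
From mathcomp Require Import all_boot all_order all_algebra.
From mathcomp Require Import all_classical all_reals all_analysis.
From mathcomp Require Import measurable_realfun ring lra.
Set Implicit Arguments.
Unset Strict Implicit.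
Unset Printing Implicit Defensive.
Import Order.TTheory GRing.Theory Num.Theory.
Import numFieldNormedType.Exports.
Local Open Scope classical_set_scope.
Local Open Scope ring_scope.

(** With [F x] the integral of [G] over [(-oo, x]], robustness reads
    [F (x + 1) <= rho * F' x], where [rho^-1 = s * exp (- s)].  For [x > 0] take
    [G x = max 1 (exp (s * (x - z)))]; for [x <= 0] let robustness be an
    equality, which turns it into the delay equation
    [F' x = s * exp (- s) * F (x + 1)], solved backwards from the values of [F]
    on [[0, 1]] one unit interval at a time.  Along a solution the quantity
    [F x * exp (- s * x) - s * \int_x^(x+1) F r * exp (- s * r) dr] is constant.
    If it is zero on the initial interval, then [F] can never vanish: at a
    rightmost zero the integral would be positive.  Making it zero there
    determines [F 1], and gives the value of [chi s]: for [s <= ln 2] with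
    [z = 1], and otherwise with [z] chosen so that [F x = exp (s * (x - z)) / s]
    for [x >= z]. *)

(** * Primitives, integrals over intervals and one-sided limits *)

Section calculus.
Context {R : realType}.
Implicit Types (f g F : R -> R) (a b x y : R).
Local Notation mu := (@lebesgue_measure R).

Lemma is_derive_continuous f x df : is_derive x 1 f df -> {for x, continuous f}.
Proof.
by move=> [fx _]; apply/differentiable_continuous/derivable1_diffP.
Qed.

(** The integral is based at -1, so that 0 is an interior point, and frozen to the left of 0; hence
    continuity on the whole line. *)
Lemma exists_primitive f : continuous f ->
  exists2 F, continuous F & forall x, 0 < x -> is_derive x 1 F (f x).
Proof.
move=> cf.
pose P x := (\int[mu]_(t in `[(-1 : R), x]) f t)%R.
have dP x : -1 < x -> is_derive x 1 P (f x).
  move=> x1; have xx1 : x < x + 1 by rewrite ltrDl.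
  have intf : mu.-integrable `[(-1 : R), x + 1] (EFin \o f).
    apply: continuous_compact_integrable; first exact: segment_compact.
    exact: continuous_subspaceT.
  have [dPx P'x] := continuous_FTC1_closed xx1 intf x1 (cf x).
  by apply: DeriveDef => //; rewrite -derive1E.
exists (fun x => P (Num.max x 0)).
  move=> x; apply: (@continuous_comp _ _ _ (fun x => Num.max x 0) P).
    by apply: continuous_max => //; exact: cst_continuous.
  apply: is_derive_continuous; apply: dP.
  by rewrite lt_max ltrN10 orbT.
move=> x x0; apply: (@near_eq_is_derive _ _ _ P).
  near=> y; rewrite max_l// ltW//.
  by near: y; exact: lt_nbhsr.
by apply: dP; rewrite (lt_trans _ x0)// ltrN10.
Unshelve. all: by end_near. Qed.

Lemma derive0_eq f a b : a <= b -> continuous f ->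
  (forall x, a < x < b -> is_derive x 1 f 0) -> f a = f b.
Proof.
move=> ab cf df.
have dfi x : x \in `]a, b[ -> is_derive x 1 f 0 by rewrite in_itv; exact: df.
have [c _] := MVT_segment ab dfi (continuous_subspaceT cf).
by rewrite mul0r => /eqP; rewrite subr_eq0 => /eqP.
Qed.

Lemma derive_gt0_lt f g a b : a < b -> continuous f ->
  (forall x, a < x < b -> is_derive x 1 f (g x)) ->
  (forall x, a < x < b -> 0 < g x) -> f a < f b.
Proof.
move=> ab cf df g0.
have dfi x : x \in `]a, b[ -> is_derive x 1 f (g x).
  by rewrite in_itv; exact: df.
have [c] := MVT ab dfi (continuous_subspaceT cf).
rewrite in_itv/= => /g0 gc0 E.
by rewrite -subr_gt0 E mulr_gt0// subr_gt0.
Qed.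

Definition has_integral (G F : R -> R) a b :=
  [/\ a <= b, measurable_fun `[a, b] G &
      (\int[mu]_(t in `[a, b]) (G t)%:E = (F b - F a)%:E)%E].

(** Agreement of [G] with [f] is asked only inside the interval, and of [F] with [P] only at its
    ends: this suits piecewise formulas that change at the ends. *)
Lemma has_integral_primitive (G F f P : R -> R) a b : a <= b ->
  continuous f -> continuous P ->
  (forall x, a < x < b -> is_derive x 1 P (f x)) ->
  {in `]a, b[, G =1 f} -> F a = P a -> F b = P b ->
  has_integral G F a b.
Proof.
move=> ab cf cP dP Gf Fa Fb.
have [eab|ltab] := eqVneq a b.
  split=> //; rewrite eab set_itv1 ?subrr; first exact: measurable_fun_set1.
  exact: integral_set1.
have {}ltab : a < b by rewrite lt_neqAle ltab.
have mf : measurable_fun setT f by exact: continuous_measurable_fun.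
have mG : measurable_fun `]a, b[ G.
  apply: (@eq_measurable_fun _ _ _ _ _ f).
    by move=> x; rewrite inE/= => xab; rewrite Gf.
  exact: measurable_funTS.
split=> //.
  by apply/measurable_fun_itv_bndo_bndcP/measurable_fun_itv_obnd_cbndP.
rewrite (@eq_integral_itv_bounded R a b f G)//; last exact: measurable_funTS.
rewrite (@continuous_FTC2 R f P)//.
- by rewrite Fa Fb EFinB.
- exact: continuous_subspaceT.
- split.
  + by move=> x; rewrite in_itv/= => /dP[].
  + exact/cvg_at_right_filter/cP.
  + exact/cvg_at_left_filter/cP.
- by move=> x; rewrite in_itv/= => /dP[_ ?]; rewrite derive1E.
Qed.

Lemma has_integral_trans (G F : R -> R) a b c : (forall x, 0 <= G x) ->
  has_integral G F a b -> has_integral G F b c -> has_integral G F a c.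
Proof.
move=> G0 [ab mab Iab] [bc mbc Ibc].
have E : `[a, c]%classic = `[a, b]%classic `|` `]b, c]%classic :> set R.
  by apply: itv_bndbnd_setU; rewrite bnd_simp.
have mac : measurable_fun `[a, c] G.
  rewrite E; apply/measurable_funU => //; split => //.
  by apply/measurable_fun_itv_obnd_cbndP.
split=> //; first exact: le_trans bc.
rewrite E ge0_integral_setU//=.
- rewrite integral_itv_obnd_cbnd.
    by rewrite Iab [X in (_ + X)%E]Ibc -EFinD addrC subrKA.
  apply/measurable_EFinP.
  exact/measurable_fun_itv_obnd_cbndP.
- by apply/measurable_EFinP; rewrite -E.
- by move=> x _; rewrite lee_fin.
- apply/disj_setPLR => x/=; rewrite !in_itv/= => /andP[_ xb].
  by apply/negP; rewrite negb_and -leNgt xb.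
Qed.

(** Monotone convergence along [[x - n, x]], dropping the nonnegative [F (x - n)]; the limit of [F]
    at minus infinity stays undetermined, hence an inequality. *)
Lemma integralNy_le (G F : R -> R) x : (forall t, 0 <= G t) ->
  measurable_fun setT G -> (forall t, 0 <= F t) ->
  (forall a, a <= x -> has_integral G F a x) ->
  (\int[mu]_(t in `]-oo, x]) (G t)%:E <= (F x)%:E)%E.
Proof.
move=> G0 mG F0 GF.
pose D n := `[x - n%:R, x]%classic : set R.
have -> : `]-oo, x]%classic = \bigcup_n D n.
  apply/seteqP; split => t; rewrite /D/= in_itv/=; last first.
    by move=> [n _] /=; rewrite in_itv/= => /andP[].
  move=> tx.
  exists (Num.truncn (x - t)).+1 => //=; rewrite in_itv/= tx andbT.
  by rewrite lerBlDr -lerBlDl; apply/ltW/truncnS_gt.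
have mD n : measurable (D n) by exact: measurable_itv.
have cv : (\int[mu]_(t in D n) (G t)%:E)%E @[n --> \oo] -->
    (\int[mu]_(t in \bigcup_n D n) (G t)%:E)%E.
  apply: ge0_nondecreasing_set_cvg_integral => //.
  - apply/nondecreasing_seqP => n; rewrite subsetEset.
    by apply: subset_itvr; rewrite bnd_simp lerD2l lerN2 ler_nat.
  - by move=> n; apply/measurable_EFinP; exact: measurable_funTS.
  - by move=> n t _; rewrite lee_fin.
apply: (cvge_to_le cv); near=> n; have [|_ _ ->] := GF (x - n%:R).
  by rewrite gerBl.
by rewrite lee_fin gerBl.
Unshelve. all: by end_near. Qed.

Lemma left_cvg (G h : R -> R) a x : a < x -> continuous h ->
  (forall t, a < t <= x -> G t = h t) -> G t @[t --> x^'-] --> G x.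
Proof.
move=> ax ch Gh; rewrite Gh ?ax ?lexx//.
apply: (cvg_trans _ (cvg_at_left_filter (ch x))).
apply: near_eq_cvg; near=> t; rewrite Gh//; apply/andP; split.
  by near: t; exact: nbhs_left_gt.
by near: t; exact: nbhs_left_le.
Unshelve. all: by end_near. Qed.

End calculus.

(** * Backward solution of the delay equation *)

Section delay.
Context {R : realType} (s : R).
Hypothesis s0 : 0 < s.
Implicit Types (g h : R -> R) (x y : R).

(* [Q] is a primitive of [g y * exp (- s * y)], so the last equation is the
   vanishing of the conserved quantity of the delay equation. *)
Definition balanced g := [/\ continuous g, (forall y, 0 <= y <= 1 -> 0 < g y) &
  exists2 Q : R -> R, continuous Q /\
    (forall y, 0 < y < 1 -> is_derive y 1 Q (g y * expR (- s * y))) &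
    g 0 = s * (Q 1 - Q 0)].

(* [g] and [h] are the restrictions of a solution to consecutive unit intervals,
   both shifted to [[0, 1]], with [h] on the left of [g]. *)
Definition delay_step g h := h 1 = g 0 /\
  forall y, 0 < y < 1 -> is_derive y 1 h (s * expR (- s) * g y).

Lemma is_derive_expRM (k x : R) :
  is_derive x 1 (fun y => expR (k * y)) (k * expR (k * x)).
Proof.
have d : is_derive x 1 (fun y => k * y) k.
  by apply: is_derive_eq; rewrite /GRing.scale/=; ring.
by have := is_derive1_comp (f := expR) (is_derive_expR (k * x)) d; rewrite mulrC.
Qed.

Lemma continuous_expRM (k : R) : continuous (fun y : R => expR (k * y)).
Proof. by move=> x; apply: is_derive_continuous (is_derive_expRM k x). Qed.

(** Integrate backwards from the value [g 0]. The conserved quantity, zero by balance of [g], yields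
    both positivity and balance of [h]. *)
Lemma delay_step_exists g : balanced g ->
  exists2 h, balanced h & delay_step g h.
Proof.
move=> [cg g0 [Q [cQ dQ] gQ]].
have [P cP dP] := exists_primitive cg.
pose a := s * expR (- s).
have a0 : 0 < a by rewrite mulr_gt0// expR_gt0.
pose h y := g 0 - a * (P 1 - P y).
have ch : continuous h.
  move=> y; apply: cvgB; first exact: cvg_cst.
  apply: cvgMl_tmp; apply: cvgB; first exact: cvg_cst.
  exact: cP.
have dh y : 0 < y -> is_derive y 1 h (a * g y).
  move=> y0; have dPy := dP _ y0.
  by apply: is_derive_eq; rewrite /GRing.scale/=; ring.
have h1 : h 1 = g 0 by rewrite /h subrr mulr0 subr0.
pose w y := h y * expR (- s * y).
have cw : continuous w.
  by move=> y; apply: cvgM; [exact: ch|exact: continuous_expRM].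
have [W cW dW] := exists_primitive cw.
(* The conserved quantity: the window of length one starting at [y] covers [[y, 1]] of [h] and
   [[0, y]] of [g], whose weight picks up [expR (- s)] from the shift by one. *)
pose E y := w y - s * ((W 1 - W y) + expR (- s) * (Q y - Q 0)).
have cE : continuous E.
  move=> y; apply: cvgB; first exact: cw.
  apply: cvgMl_tmp; apply: cvgD.
    by apply: cvgB; [exact: cvg_cst|exact: cW].
  by apply: cvgMl_tmp; apply: cvgB; [exact: cQ|exact: cvg_cst].
have dE y : 0 < y < 1 -> is_derive y 1 E 0.
  move=> y01; have [y0 _] := andP y01.
  have dhy := dh _ y0; have dWy := dW _ y0; have dQy := dQ _ y01.
  have dey := is_derive_expRM (- s) y.
  rewrite /E /w; apply: is_derive_eq.
  rewrite /GRing.scale/= /w /a; ring.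
have E1 : E 1 = 0.
  by rewrite /E /w h1 gQ subrr add0r mulr1; ring.
have E0 y : 0 <= y <= 1 -> E y = 0.
  move=> /andP[y0 y1]; rewrite -[RHS]E1.
  apply: (derive0_eq y1 cE) => x /andP[yx x1].
  by apply: dE; rewrite x1 (le_lt_trans y0).
(* By strict increase, [h] is positive to the right of any zero. *)
have hlt x y : 0 <= x -> x < y -> y <= 1 -> h x < h y.
  move=> x0 xy y1.
  apply: (derive_gt0_lt (g := fun t => a * g t) xy ch) => t /andP[xt ty].
    by apply: dh; exact: le_lt_trans xt.
  rewrite mulr_gt0// g0// (le_trans x0 (ltW xt))/=.
  exact: ltW (lt_le_trans ty y1).
(* Otherwise [h] vanishes at some [t < 1], since [h 1 = g 0 > 0]. Then [E t = 0] makes the window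
   integral zero, although its part over [[t, 1]] is positive. *)
have h0 y : 0 <= y <= 1 -> 0 < h y.
  move=> /andP[y0 y1]; rewrite ltNge; apply/negP => hy.
  have g00 : 0 < g 0 by apply: g0; rewrite lexx ler01.
  have [||t] := @IVT R h y 1 0 y1.
  - exact: continuous_subspaceT.
  - by rewrite ge_min hy le_max h1 (ltW g00) orbT.
  rewrite in_itv/= => /andP[yt t1] ht.
  have t0 : 0 <= t := le_trans y0 yt.
  have {}t1 : t < 1.
    rewrite lt_neqAle t1 andbT; apply/eqP => t1e.
    by move: ht; rewrite t1e h1 => g0e; rewrite g0e ltxx in g00.
  have Wt : W t < W 1.
    apply: (derive_gt0_lt (g := w) t1 cW) => x /andP[tx x1].
      by apply: dW; exact: le_lt_trans tx.
    by rewrite mulr_gt0 ?expR_gt0// -ht hlt// ltW.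
  have Qt : Q 0 <= Q t.
    have [->//|tn0] := eqVneq t 0.
    have tgt0 : 0 < t by rewrite lt_def tn0.
    apply/ltW/(derive_gt0_lt (g := fun y => g y * expR (- s * y)) tgt0 cQ) => x
      /andP[x0 xt].
      by apply: dQ; rewrite x0 (lt_trans xt).
    by rewrite mulr_gt0 ?expR_gt0// g0// (ltW x0) ltW// (lt_trans xt).
  have : 0 < s * ((W 1 - W t) + expR (- s) * (Q t - Q 0)).
    rewrite mulr_gt0// ltr_pwDl ?subr_gt0//.
    by rewrite mulr_ge0 ?expR_ge0// subr_ge0.
  have := E0 t; rewrite t0 (ltW t1) => /(_ isT) /eqP.
  by rewrite /E /w ht mul0r sub0r oppr_eq0 => /eqP ->; rewrite ltxx.
exists h; last by split; [exact: h1|move=> y /andP[y0 _]; exact: dh].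
split; [exact: ch|exact: h0|exists W].
  by split; [exact: cW|move=> y /andP[y0 _]; exact: dW].
have := E0 0; rewrite lexx ler01 => /(_ isT) /eqP.
by rewrite /E /w subrr !mulr0 expR0 mulr1 addr0 subr_eq0 => /eqP.
Qed.

(** Balance is bundled into the type, so that every element has a successor, as dependent choice
    requires. *)
Lemma delay_sequence g : balanced g -> exists u : nat -> R -> R,
  [/\ u 0%N = g, forall n, balanced (u n) &
      forall n, delay_step (u n) (u n.+1)].
Proof.
move=> bg.
pose T := {h | balanced h}.
have [v|f [f0 fS]] := @dependent_choice T
    (fun v w : T => delay_step (sval v) (sval w)) _ (exist _ g bg).
  have [h bh gh] := cid2 (delay_step_exists (svalP v)).
  by exists (exist _ h bh).
exists (fun n => sval (f n)); split; [by rewrite f0| |exact: fS].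
by move=> n; exact: (svalP (f n)).
Qed.

End delay.

(** * The profile on the right of 0 and its primitive *)

Section profile.
Context {R : realType} (s z d : R).
Hypotheses (s0 : 0 < s) (z01 : 0 <= z <= 1) (d0 : d <= 0).
(** The value of [history] at 0, chosen so that the linear and exponential branches meet at [z]:
    [c + z = s^-1 + d]. *)
Let c := d + s^-1 - z.
Hypothesis c0 : 0 < c.
(* Evaluating the integral, this is equivalent to
   [history 0 = s * \int_0^1 history y * exp (- s * y) dy]. *)
Hypothesis balance : 1 - 2 * expR (- s * z) + s * (1 - z) * expR (- s * z) =
  s * d * expR (- s).
Implicit Types a b x y t : R.

(** Here and in [history], [max] and [min] replace a case distinction at [z], so that continuity
    follows by composition. *)
Definition slope x := expR (s * (Num.max x z - z)).
Definition history x := c + Num.min x z + (slope x - 1) / s.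

Let z0 : 0 <= z. Proof. by case/andP: z01. Qed.
Let z1 : z <= 1. Proof. by case/andP: z01. Qed.
Let sn0 : s != 0. Proof. by rewrite gt_eqF. Qed.

Lemma slope_le x : x <= z -> slope x = 1.
Proof. by move=> xz; rewrite /slope max_r// subrr mulr0 expR0. Qed.

Lemma slope_ge x : z <= x -> slope x = expR (s * (x - z)).
Proof. by move=> xz; rewrite /slope max_l. Qed.

Lemma history_le x : x <= z -> history x = c + x.
Proof. by move=> xz; rewrite /history slope_le// min_l// subrr mul0r addr0. Qed.

Lemma history_ge x : z <= x -> history x = expR (s * (x - z)) / s + d.
Proof. by move=> xz; rewrite /history slope_ge// min_r// /c; field. Qed.

Lemma slope_ge1 x : 1 <= slope x.
Proof.
rewrite -[leLHS]expR0 ler_expR mulr_ge0 ?(ltW s0)// subr_ge0.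
by rewrite le_max lexx orbT.
Qed.

Lemma slope_homo : {homo slope : x y / x <= y}.
Proof.
move=> x y xy; rewrite ler_expR ler_pM2l// lerD2r.
by rewrite ge_max !le_max xy lexx orbT.
Qed.

Lemma continuous_slope : continuous slope.
Proof.
move=> x; apply: (@continuous_comp _ _ _ (fun x => s * (Num.max x z - z)) expR).
  apply: cvgMl_tmp; apply: cvgB; last exact: cvg_cst.
  by apply: continuous_max => //; exact: cst_continuous.
exact: continuous_expR.
Qed.

Lemma continuous_history : continuous history.
Proof.
move=> x; apply: cvgD.
  apply: cvgD; first exact: cvg_cst.
  by apply: continuous_min => //; exact: cst_continuous.
apply: cvgMr_tmp; apply: cvgB; last exact: cvg_cst.
exact: continuous_slope.
Qed.

Lemma is_derive_expR_shift x :
  is_derive x 1 (fun y => expR (s * (y - z)) / s + d) (expR (s * (x - z))).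
Proof.
have -> : (fun y => expR (s * (y - z)) / s + d) =
    (fun y => expR (- (s * z)) / s * expR (s * y) + d).
  by apply/funext => y; rewrite mulrBr addrC expRD; field.
have de := is_derive_expRM s x.
apply: is_derive_eq; rewrite /GRing.scale/= mulrBr [in RHS]addrC expRD.
by field.
Qed.

Lemma is_derive_history x : x != z -> is_derive x 1 history (slope x).
Proof.
rewrite neq_lt => /orP[xz|xz].
  rewrite slope_le ?ltW//; apply: (@near_eq_is_derive _ _ _ (fun y => c + y)).
    by near=> y; rewrite history_le// ltW//; near: y; exact: lt_nbhsl.
  by apply: is_derive_eq; ring.
rewrite slope_ge ?ltW//.
apply: (@near_eq_is_derive _ _ _ (fun y => expR (s * (y - z)) / s + d)).
  by near=> y; rewrite history_ge// ltW//; near: y; exact: lt_nbhsr.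
exact: is_derive_expR_shift.
Unshelve. all: by end_near. Qed.

Lemma history_gt0 y : 0 <= y -> 0 < history y.
Proof.
move=> y0; rewrite ltr_wpDr//.
  by rewrite divr_ge0 ?(ltW s0)// subr_ge0 slope_ge1.
by rewrite ltr_wpDr// le_min y0.
Qed.

Lemma balanced_history : balanced s history.
Proof.
split; first exact: continuous_history.
  by move=> y /andP[y0 _]; exact: history_gt0.
pose w y := history y * expR (- s * y).
have cw : continuous w.
  by move=> y; apply: cvgM; [exact: continuous_history|exact: continuous_expRM].
have [Q cQ dQ] := exists_primitive cw.
exists Q; first by split; [exact: cQ|move=> y /andP[y0 _]; exact: dQ].
(* [A] and [B] are explicit primitives of [w] to the left and right of [z]. On the right the weight
   cancels the exponential, whence the linear term of [B]. *)
pose A y := - ((c + y) / s + s^-1 ^+ 2) * expR (- s * y).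
pose B y := y * (expR (- s * z) / s) - d / s * expR (- s * y).
have dA x : is_derive x 1 A ((c + x) * expR (- s * x)).
  have de := is_derive_expRM (- s) x.
  by rewrite /A; apply: is_derive_eq; rewrite /GRing.scale/=; field.
have dB x : is_derive x 1 B ((expR (s * (x - z)) / s + d) * expR (- s * x)).
  have de := is_derive_expRM (- s) x.
  rewrite /B; apply: is_derive_eq; rewrite /GRing.scale/=.
  have -> : expR (- s * z) = expR (s * (x - z)) * expR (- s * x).
    by rewrite -expRD; congr expR; ring.
  by field.
have cA : continuous A by move=> x; exact: is_derive_continuous (dA x).
have cB : continuous B by move=> x; exact: is_derive_continuous (dB x).
have QA : Q 0 - A 0 = Q z - A z.
  have cQA : continuous (fun x => Q x - A x).
    by move=> x; apply: cvgB; [exact: cQ|exact: cA].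
  apply: (derive0_eq z0 cQA) => x /andP[x0 xz].
  have dQx := dQ _ x0; have dAx := dA x.
  by apply: is_derive_eq; rewrite /w history_le ?ltW// subrr.
have QB : Q z - B z = Q 1 - B 1.
  have cQB : continuous (fun x => Q x - B x).
    by move=> x; apply: cvgB; [exact: cQ|exact: cB].
  apply: (derive0_eq z1 cQB) => x /andP[xz x1].
  have dQx := dQ _ (le_lt_trans z0 xz); have dBx := dB x.
  by apply: is_derive_eq; rewrite /w history_ge ?ltW// subrr.
have -> : Q 1 - Q 0 = (A z - A 0) + (B 1 - B z).
  move: QA QB; lra.
rewrite history_le// /A /B !mulr0 expR0 !mulr1 !addr0.
have := balance; set p := expR (- s * z); set q := expR (- s) => bal.
have dq : d * q = (1 - 2 * p + s * (1 - z) * p) / s.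
  by rewrite bal; field.
(* The evaluated integral; by [balance] the last two terms cancel and leave [c], the value at 0. *)
rewrite [RHS](_ : _ = c + (1 - 2 * p + s * (1 - z) * p) / s - d * q).
  by rewrite dq; ring.
by rewrite /c; field.
Qed.

(** * Gluing the unit intervals into a profile on the line *)

Section glue.
Variable u : nat -> R -> R.
Hypotheses (u0 : u 0%N = history) (bu : forall n, balanced s (u n))
  (du : forall n, delay_step s (u n) (u n.+1)).

(** For [n] the integer part of [- x], the argument lies in []-(n+1), -n]], the cell of [u n.+1],
    and is shifted into []0, 1]]. *)
Definition cumul x := if x <= 0 then
  u (Num.truncn (- x)).+1 (x + (Num.truncn (- x)).+1%:R) else history x.

(** On the left branch robustness is an equality. The point 0 belongs to this branch for the sake of
    left continuity. *)
Definition profile x :=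
  if x <= 0 then s * expR (- s) * cumul (x + 1) else slope x.

Let a0 : 0 < s * expR (- s). Proof. by rewrite mulr_gt0// expR_gt0. Qed.

(** At the left endpoint the truncation already selects the next cell; the matching condition of
    [delay_step] makes the two values agree. *)
Lemma cumul_cell n x : - n.+1%:R <= x <= - n%:R ->
  cumul x = u n.+1 (x + n.+1%:R).
Proof.
move=> /andP[nx xn]; rewrite /cumul (le_trans xn) ?oppr_le0//.
have [->|xn1] := eqVneq x (- n.+1%:R).
  have -> : Num.truncn (- - n.+1%:R : R) = n.+1.
    by rewrite opprK natrK.
  by rewrite addNr -[n.+2%:R]natr1 addrA addNr add0r; case: (du n.+1).
have -> : Num.truncn (- x) = n.
  by apply: truncn_def; rewrite lerNr xn ltrNl lt_def xn1.
by [].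
Qed.

Lemma cumul_pos x : 0 <= x -> cumul x = history x.
Proof.
rewrite le_eqVlt => /predU1P[<-|x0]; last by rewrite /cumul leNgt x0.
rewrite (@cumul_cell 0) ?oppr0 ?lexx ?oppr_le0 ?ler01//.
by rewrite add0r -u0; case: (du 0).
Qed.

Lemma cell_exists x : x <= 0 -> exists n, - n.+1%:R < x <= - n%:R.
Proof.
move=> x0; exists (Num.truncn (- x)).
have /truncn_itv /andP[] : 0 <= - x by rewrite oppr_ge0.
by rewrite lerNr => -> /=; rewrite ltrNl => ->.
Qed.

Lemma cumul_gt0 x : 0 < cumul x.
Proof.
have [x0|/ltW x0] := leP x 0; last by rewrite cumul_pos// history_gt0.
have [n /andP[nx xn]] := cell_exists x0.
rewrite (@cumul_cell n) ?(ltW nx)//; case: (bu n.+1) => _ + _; apply.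
by move: nx xn; rewrite -natr1; lra.
Qed.

Lemma profile_cell n x : - n.+1%:R <= x <= - n%:R ->
  profile x = s * expR (- s) * u n (x + n.+1%:R).
Proof.
move=> /andP[nx xn]; rewrite /profile (le_trans xn) ?oppr_le0//; congr (_ * _).
case: n nx xn => [|n] nx xn; first by rewrite cumul_pos ?u0//; lra.
have -> : x + n.+2%:R = x + 1 + n.+1%:R by rewrite -[n.+2%:R]natr1; ring.
by apply: cumul_cell; move: nx xn; rewrite -!natr1; lra.
Qed.

Lemma profile_gt0 x : 0 < profile x.
Proof.
rewrite /profile; case: ifPn => _; first by rewrite mulr_gt0// cumul_gt0.
exact: expR_gt0.
Qed.

Lemma has_integral_cell n a b : - n.+1%:R <= a -> a <= b -> b <= - n%:R ->
  has_integral profile cumul a b.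
Proof.
move=> na ab bn.
have sh : continuous (fun x : R => x + n.+1%:R).
  by move=> x; apply: cvgD; [exact: cvg_id|exact: cvg_cst].
apply: (@has_integral_primitive R _ _
  (fun x => s * expR (- s) * u n (x + n.+1%:R))
  (fun x => u n.+1 (x + n.+1%:R)) _ _ ab).
- move=> x; apply: cvgMl_tmp; apply: (continuous_comp (sh x)).
  by case: (bu n) => + _ _; exact.
- move=> x; apply: (continuous_comp (sh x)).
  by case: (bu n.+1) => + _ _; exact.
- move=> x /andP[ax xb].
  have x01 : 0 < x + n.+1%:R < 1.
    by move: na bn ax xb; rewrite -natr1; lra.
  have dx : is_derive x 1 (fun x : R => x + n.+1%:R) 1.
    by apply: is_derive_eq; rewrite addr0.
  have := @is_derive1_comp R (u n.+1) (fun x => x + n.+1%:R) x _ _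
    ((du n).2 _ x01) dx.
  by rewrite mulr1.
- move=> x; rewrite in_itv/= => /andP[ax xb]; rewrite (@profile_cell n)//.
  by rewrite (le_trans na (ltW ax)) (le_trans (ltW xb)).
- by rewrite (@cumul_cell n)// na (le_trans ab).
- by rewrite (@cumul_cell n)// bn (le_trans na).
Qed.

(** The point [z] is kept out of the interior because the derivative of [history] is computed on
    each side of it. *)
Lemma has_integral_history a b : 0 <= a -> a <= b -> ~~ (a < z < b) ->
  has_integral profile cumul a b.
Proof.
move=> a_ge0 ab zab.
apply: (has_integral_primitive ab continuous_slope continuous_history).
- move=> x xab; apply: is_derive_history; apply: contraNneq zab => <-.
  exact: xab.
- move=> x; rewrite in_itv/= => /andP[ax _].
  by rewrite /profile leNgt (le_lt_trans a_ge0 ax).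
- exact: cumul_pos.
- by rewrite cumul_pos// (le_trans a_ge0).
Qed.

Lemma has_integral_profile a b : a <= b -> has_integral profile cumul a b.
Proof.
have G0 x : 0 <= profile x by apply/ltW/profile_gt0.
(* Induction on the number of cells left of 0, cutting at [- n]; the base case cuts at [z]. *)
have main n : forall a b, - n%:R <= a -> a <= b -> has_integral profile cumul a b.
  elim: n => [|n IH] {}a {}b.
    rewrite oppr0 => a_ge0 ab.
    have [/andP[az zb]|] := boolP (a < z < b); last exact: has_integral_history.
    apply: (@has_integral_trans _ _ _ _ z) => //;
      apply: has_integral_history => //;
      by rewrite ?ltW// ltxx ?andbF.
  move=> na ab.
  have [bn|/ltW nb] := leP b (- n%:R); first exact: (@has_integral_cell n).
  have [an|/ltW an] := leP (- n%:R) a; first exact: IH.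
  apply: (@has_integral_trans _ _ _ _ (- n%:R)) => //.
    exact: (@has_integral_cell n).
  exact: IH.
apply: (main (Num.truncn (- a)).+1).
by rewrite lerNl; apply/ltW/truncnS_gt.
Qed.

Lemma cumul_homo : {homo cumul : x y / x <= y}.
Proof.
move=> x y /has_integral_profile[_ _ I].
rewrite -subr_ge0 -lee_fin -I; apply: integral_ge0 => t _.
by rewrite lee_fin ltW// profile_gt0.
Qed.

Lemma history1 : history 1 = expR (s * (1 - z)) / s + d.
Proof. by rewrite history_ge. Qed.

Lemma delay_coef : s * expR (- s) * (expR s / s) = 1.
Proof. by rewrite expRN; field; rewrite sn0 gt_eqF ?expR_gt0. Qed.

(** Follows from [d <= 0] and [z >= 0]. It bounds [profile 0] by 1, so the profile does not drop on
    crossing 0. *)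
Lemma history1_le : s * expR (- s) * history 1 <= 1.
Proof.
rewrite -[leRHS]delay_coef ler_pM2l// history1.
apply: (@le_trans _ _ (expR (s * (1 - z)) / s)); first by rewrite gerDl.
by rewrite ler_pM2r ?invr_gt0// ler_expR ler_piMr ?(ltW s0)// gerBl.
Qed.

Lemma profile_homo : {homo profile : x y / x <= y}.
Proof.
move=> x y xy; rewrite /profile.
have [y0|y0] := leP y 0.
  by rewrite (le_trans xy y0) ler_pM2l// cumul_homo// lerD2r.
have [x0|x0] := leP x 0; last exact: slope_homo.
apply: (le_trans _ (slope_ge1 y)); apply: le_trans history1_le.
by rewrite ler_pM2l// -cumul_pos// cumul_homo// gerDr.
Qed.

Lemma history_lt1 y : 0 <= y < 1 -> history y < history 1.
Proof.
move=> /andP[y0 y1]; have [yz|/ltW zy] := leP y z.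
  (* The tangent bound on the exponential gives [c + 1 <= history 1]. *)
  rewrite history_le// history1; have := expR_ge1Dx (s * (1 - z)).
  move=> /(ler_wpM2r (_ : 0 <= s^-1)); rewrite invr_ge0 (ltW s0) => /(_ isT).
  have -> : (1 + s * (1 - z)) / s = s^-1 + (1 - z) by field.
  by rewrite /c; lra.
rewrite history_ge// history1 ltrD2r ltr_pM2r ?invr_gt0// ltr_expR ltr_pM2l//.
by rewrite ltrD2r.
Qed.

Lemma profile_lt1 x : x < 0 -> profile x < 1.
Proof.
move=> x0; rewrite /profile ltW//; apply: lt_le_trans history1_le.
rewrite ltr_pM2l//; have [x1|x1] := leP 0 (x + 1).
  by rewrite cumul_pos// history_lt1// x1 gtrDr.
apply: (@le_lt_trans _ _ (cumul 0)); first by rewrite cumul_homo// ltW.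
by rewrite cumul_pos// history_lt1// lexx ltr01.
Qed.

(** An equality by construction for [x <= 0]; for [x > 0], drop [d <= 0] and compare exponents. *)
Lemma cumul_robust x : cumul (x + 1) <= expR s / s * profile x.
Proof.
rewrite /profile; have [x0|x0] := leP x 0.
  by rewrite mulrA [X in X * _]mulrC delay_coef mul1r.
rewrite cumul_pos ?addr_ge0 ?(ltW x0)// history_ge; last first.
  by rewrite (le_trans z1)// lerDr ltW.
apply: (@le_trans _ _ (expR (s * (x + 1 - z)) / s)); first by rewrite gerDl.
rewrite mulrAC ler_pM2r ?invr_gt0// /slope -expRD ler_expR.
rewrite -{2}(mulr1 s) -mulrDr ler_pM2l//.
by rewrite addrAC addrC lerD2l lerD2r le_max lexx.
Qed.

(** Since [cumul] dominates the integral from minus infinity, both integral conditions become bounds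
    on [cumul], at [x + 1] and at 1. *)
Lemma bidding_profile_glue : bidding_profile (expR s / s) (history 1) profile.
Proof.
have P0 x : 0 <= profile x by rewrite ltW// profile_gt0.
have C0 x : 0 <= cumul x by rewrite ltW// cumul_gt0.
have I x : (\int[@lebesgue_measure R]_(t in `]-oo, x]) (profile t)%:E
    <= (cumul x)%:E)%E.
  apply: integralNy_le => //.
    by apply: nondecreasing_measurable => //; exact: profile_homo.
  by move=> a; exact: has_integral_profile.
split; first exact: profile_homo.
split.
  move=> x; have [x0|x0] := leP x 0.
    have [n /andP[nx xn]] := cell_exists x0.
    apply: (@left_cvg _ _ (fun t => s * expR (- s) * u n (t + n.+1%:R)) _ _ nx).
      move=> t; apply: cvgMl_tmp.
      apply: (@continuous_comp _ _ _ (fun t : R => t + n.+1%:R) (u n)).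
        by apply: cvgD; [exact: cvg_id|exact: cvg_cst].
      by case: (bu n) => + _ _; exact.
    move=> t /andP[nt tx]; apply: profile_cell.
    by rewrite (ltW nt) (le_trans tx).
  apply: (left_cvg x0 continuous_slope) => t /andP[t0 _].
  by rewrite /profile leNgt t0.
split; first exact: profile_gt0.
split; first exact: profile_lt1.
split; first by move=> x x0; rewrite /profile (leNgt x) x0; exact: slope_ge1.
split; last by rewrite -(cumul_pos ler01); exact: I.
move=> x; apply: (le_trans (I _)); rewrite lee_fin; exact: cumul_robust.
Qed.

End glue.

Lemma bidding_profile_exists :
  exists G, bidding_profile (expR s / s) (expR (s * (1 - z)) / s + d) G.
Proof.
have [u [u0 bu du]] := delay_sequence s0 balanced_history.
by exists (profile u); rewrite -history1; exact: bidding_profile_glue.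
Qed.

End profile.

(** * Choice of [z] and [d] for each [s] *)

Lemma xi_sP (R : realType) (s : R) : ln 2 <= s <= 1 ->
  1 <= xi_s s <= expR 1 /\ xi_s s * (2 - ln (xi_s s)) = expR s.
Proof.
move=> /andP[ls s1].
suff /(xgetPex 1) : exists xi, [set xi : R |
    1 <= xi <= expR 1 /\ xi * (2 - ln xi) = expR s] xi by [].
(* The equation for [xi] in the variable [y = ln xi]; [f] takes the values 2 at 0 and [expR 1] at 1,
   which enclose [expR s]. *)
pose f (y : R) := expR y * (2 - y).
have cf : continuous f.
  move=> y; apply: cvgM; first exact: continuous_expR.
  by apply: cvgB; [exact: cvg_cst|exact: cvg_id].
have [||y] := @IVT R f 0 1 (expR s) ler01.
- exact: continuous_subspaceT.
- rewrite /f expR0 mul1r subr0 ge_min le_max.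
  have -> : (2 - 1 : R) = 1 by ring.
  have s2 : 2 <= expR s by rewrite -[leLHS]lnK ?posrE// ler_expR.
  have se : expR s <= expR 1 by rewrite ler_expR.
  by rewrite mulr1 s2 se orbT.
rewrite in_itv/= => /andP[y0 y1] fy; exists (expR y) => /=; split.
  by rewrite -[leLHS]expR0 !ler_expR y0 y1.
by rewrite expRK.
Qed.

Theorem theorem2 (R : realType) (s : R) :
  0 < s <= 1 ->
  exists G : R -> R, bidding_profile (rho_s s) (chi_s s) G.
Proof.
move=> /andP[s0 s1]; rewrite /rho_s /chi_s.
have sn0 : s != 0 by rewrite gt_eqF.
have es_gt : 1 + s < expR s by exact: expR_gt1Dx.
have [sl|sl] := leP s (ln 2).
  have es2 : expR s <= 2 by rewrite -[leRHS]lnK ?posrE// ler_expR.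
  (* With [z = 1], balance forces [d = (expR s - 2) / s], which is nonpositive because [s <= ln 2];
     [es_gt] gives [c > 0]. *)
  have -> : (expR s - 1) / s = expR (s * (1 - 1)) / s + (expR s - 2) / s.
    by rewrite subrr mulr0 expR0; field.
  apply: bidding_profile_exists => //.
  - by rewrite ler01 lexx.
  - by rewrite pmulr_lle0 ?invr_gt0// subr_le0.
  - have -> : (expR s - 2) / s + s^-1 - 1 = (expR s - 1 - s) / s by field.
    by rewrite divr_gt0//; lra.
  - rewrite !mulr1 subrr mulr0 mul0r addr0 [s * _]mulrC divfK//.
    by rewrite mulrBl -expRD subrr expR0.
have [/andP[xi1 xie] xiE] : 1 <= xi_s s <= expR 1 /\
    xi_s s * (2 - ln (xi_s s)) = expR s by apply: xi_sP; rewrite (ltW sl).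
have xi0 : 0 < xi_s s by exact: lt_le_trans xi1.
set y := ln (xi_s s) in xiE *.
have xiy : xi_s s = expR y by rewrite lnK.
have y0 : 0 <= y by rewrite ln_ge0.
have y1 : y <= 1 by rewrite -[leRHS]expRK ler_ln ?posrE// expR_gt0.
(* Strictness serves [c = (1 - s + y) / s > 0], which at [s = 1] rests on [y] alone. *)
have y_gt0 : 0 < y.
  rewrite lt_def y0 andbT; apply: contraTneq sl => ye0.
  have -> : 2 = expR s by rewrite -xiE xiy ye0 expR0 mul1r subr0.
  by rewrite expRK ltxx.
have ysE : 2 - y = expR (s - y).
  by rewrite expRB -xiE xiy mulrC mulKf// gt_eqF// expR_gt0.
have ys : y <= s.
  by rewrite -subr_ge0 -ler_expR expR0 -ysE; lra.
(* Here [d = 0] and [z = 1 - y / s], so that [s * z = s - y] and balance becomes [ysE], the defining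
   equation of [xi]. *)
have -> : xi_s s / s = expR (s * (1 - (1 - y / s))) / s + 0.
  by rewrite addr0 xiy; congr (expR _ / _); field.
apply: bidding_profile_exists => //.
- rewrite subr_ge0 ler_pdivrMr// mul1r ys gerBl.
  exact: divr_ge0 (ltW s0).
- have -> : 0 + s^-1 - (1 - y / s) = (1 - s + y) / s by field.
  by rewrite divr_gt0//; lra.
- have -> : s * (1 - (1 - y / s)) = y by field.
  have -> : - s * (1 - y / s) = - (s - y) by field.
  rewrite mulr0 mul0r expRN -ysE; field.
  by rewrite ysE gt_eqF// expR_gt0.
Qed.
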